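(* Let $G$ and $H$ be graphs, where $G$ has no isolated vertices. Then $$\gamma_{gr}^{t}(G\boxtimes H)\ \ge\ \max\big\{(\gamma_{gr}(G)+1)\,c(D)+\gamma_{gr}(G)\,b(D)+(|\widehat{D}|-b(D)-c(D))\,\gamma_{gr}^{t}(G)\ :\ D\text{ is a dominating sequence of }H\big\}.$$
   Context: Graphs are finite, simple and undirected, with nonempty vertex set. $N(v)$ and $N[v]=N(v)\cup\{v\}$ denote open and closed neighborhoods. A legal open neighborhood sequence of a graph is a sequence $(v_1,\ldots,v_k)$ of distinct vertices with $N(v_i)\setminus\bigcup_{j=1}^{i-1}N(v_j)\neq\emptyset$ for each $i$; its maximum length is the Grundy total domination number $\gamma_{gr}^{t}$. A dominating sequence (legal closed neighborhood sequence) is a sequence $(d_1,\ldots,d_k)$ of distinct vertices with $N[d_i]\setminus\bigcup_{j=1}^{i-1}N[d_j]\neq\emptyset$ for each $i$; its maximum length is the Grundy domination number $\gamma_{gr}$. In a dominating sequence $D=(d_1,\ldots,d_k)$, the vertex $d_i$ footprints the vertices of $N[d_i]\setminus\bigcup_{j=1}^{i-1}N[d_j]$. $\widehat{D}=\{d_1,\ldots,d_k\}$. $c(D)$ is the number of vertices $d_i$ of $D$ that footprint themselves and at least one of their neighbors; $b(D)$ is the number of vertices $d_i$ of $D$ that do not footprint themselves and footprint at least one of their neighbors. The strong product $G\boxtimes H$ has vertex set $V(G)\times V(H)$, and $(g_1,h_1)$, $(g_2,h_2)$ are adjacent iff $g_1g_2\in E(G)$ and $h_1=h_2$, or $g_1=g_2$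 and $h_1h_2\in E(H)$, or $g_1g_2\in E(G)$ and $h_1h_2\in E(H)$. *)

(* Defs.v *)
From mathcomp Require Import all_boot.

Set Implicit Arguments.
Unset Strict Implicit.
Unset Printing Implicit Defensive.

Record sgraph := SGraph {
  vertex :> finType;
  edge : rel vertex;
  edge_sym : symmetric edge;
  edge_irr : irreflexive edge;
  vertex_card_gt0 : 0 < #|vertex|
}.

Definition open_nbhd (G : sgraph) (v : G) : {set G} := [set w | edge v w].

Definition closed_nbhd (G : sgraph) (v : G) : {set G} := v |: open_nbhd v.

Definition no_isolated (G : sgraph) : Prop := forall v : G, exists w : G, edge v w.

Section Sequences.

Variables (T : finType) (N : T -> {set T}).

(* Positions are 0-based: [term s i] is the (i+1)-st entry of [s]. *)
Definition term (s : seq T) (i : 'I_(size s)) : T := tnth (in_tuple s) i.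

Definition footprint (s : seq T) (i : 'I_(size s)) : {set T} :=
  N (term i) :\: \bigcup_(j < size s | j < i) N (term j).

Definition legal (s : seq T) : bool :=
  uniq s && [forall i : 'I_(size s), footprint i != set0].

Lemma legal_size (s : seq T) : legal s -> size s <= #|T|.
Proof. by case/andP=> /card_uniqP us _; rewrite -us; apply: max_card. Qed.

(* By [legal_size], the sequences of length at most #|T| include all legal
   ones, so this maximum is over all legal sequences. *)
Definition max_legal : nat :=
  \max_(s : {bseq #|T| of T} | legal s) size s.

End Sequences.

Definition dominating_seq (G : sgraph) (D : seq G) : bool :=
  legal (@closed_nbhd G) D.

Definition grundy_dom (G : sgraph) : nat := max_legal (@closed_nbhd G).

Definition grundy_total_dom (G : sgraph) : nat := max_legal (@open_nbhd G).

Section Counts.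

Variables (G : sgraph) (D : seq G).

Definition footprints_self (i : 'I_(size D)) : bool :=
  term i \in footprint (@closed_nbhd G) i.

Definition footprints_neighbor (i : 'I_(size D)) : bool :=
  [exists w in open_nbhd (term i), w \in footprint (@closed_nbhd G) i].

(* Entries of a dominating sequence are distinct, so counting positions is
   counting vertices. *)
Definition c_count : nat :=
  #|[set i | footprints_self i && footprints_neighbor i]|.

Definition b_count : nat :=
  #|[set i | ~~ footprints_self i && footprints_neighbor i]|.

Lemma b_add_c_le : uniq D -> b_count + c_count <= #|[set x in D]|.
Proof.
move=> uD; rewrite cardsE (card_uniqP uD) -cardsUI [X in _ + X]eq_card0.
  by rewrite addn0 -[X in _ <= X]card_ord max_card.
by move=> i; rewrite !inE; case: footprints_self; rewrite ?andbF.
Qed.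

End Counts.

Section StrongProduct.

Variables G H : sgraph.

Definition strong_edge : rel (G * H) := fun x y =>
  [|| edge x.1 y.1 && (x.2 == y.2),
      (x.1 == y.1) && edge x.2 y.2
    | edge x.1 y.1 && edge x.2 y.2].

Lemma strong_edge_sym : symmetric strong_edge.
Proof.
move=> x y; rewrite /strong_edge ![edge x.1 _]edge_sym ![edge x.2 _]edge_sym.
by rewrite (eq_sym x.1) (eq_sym x.2).
Qed.

Lemma strong_edge_irr : irreflexive strong_edge.
Proof. by move=> x; rewrite /strong_edge !edge_irr andbF. Qed.

Lemma strong_card_gt0 : 0 < #|{: G * H}|.
Proof. by rewrite card_prod muln_gt0 !vertex_card_gt0. Qed.

Definition strong_prod : sgraph :=
  SGraph strong_edge_sym strong_edge_irr strong_card_gt0.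

End StrongProduct.

(* Main.v *)
Require Import Defs.
From mathcomp Require Import all_boot.

Set Implicit Arguments.
Unset Strict Implicit.
Unset Printing Implicit Defensive.

(** Let [D = (d_1, ..., d_k)] be a dominating sequence of [H]. For each [d_i] in
    turn, append a block of vertices in the layer [G x {d_i}]. A vertex whose
    second coordinate is footprinted by [d_i] has no neighbor in the earlier
    layers, so a block only has to be legal on [G x X], with [X] the footprint
    of [d_i].
    If [d_i] footprints only itself, a legal open sequence of [G] works, with
    witnesses in the layer of [d_i]. If [d_i] footprints a neighbor [w], a legal
    closed sequence of [G] works, with witnesses in the layer of [w]. If it also
    footprints itself, one more vertex fits: the last vertex of a longest closed
    sequence can be replaced by a vertex [x] that it footprints; then [x] has no
    neighbor in the sequence, so any neighbor of [x] in the layer of [d_i]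
    has [(x, d_i)] as a new neighbor. *)

(** * Legality relative to an already covered set *)

Section LegalFrom.

Variables (T : finType) (N : T -> {set T}).

(** [A] collects what earlier vertices have covered, so a concatenation can be checked block by
    block. Distinctness is not tested: a repeated vertex covers nothing new. *)
Fixpoint legal_from (A : {set T}) (s : seq T) : bool :=
  if s is x :: s' then ~~ (N x \subset A) && legal_from (A :|: N x) s'
  else true.

Definition covered (s : seq T) : {set T} := \bigcup_(x <- s) N x.

Lemma coveredP (s : seq T) (y : T) :
  reflect (exists2 x, x \in s & y \in N x) (y \in covered s).
Proof.
apply: (iffP idP); rewrite /covered.
  elim: s => [|x s IHs]; first by rewrite big_nil inE.
  rewrite big_cons inE => /orP[yx|/IHs[z zs yz]].
    by exists x; rewrite ?mem_head.
  by exists z; rewrite // inE zs orbT.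
case=> x; elim: s => // z s IHs; rewrite inE big_cons inE => /orP[/eqP-> ->//|].
by move=> /IHs h /h ->; rewrite orbT.
Qed.

Lemma legal_from_cat (A : {set T}) (s1 s2 : seq T) :
  legal_from A (s1 ++ s2) =
  legal_from A s1 && legal_from (A :|: covered s1) s2.
Proof.
elim: s1 A => [|x s1 IHs1] A /=; first by rewrite /covered big_nil setU0.
by rewrite IHs1 /covered big_cons setUA andbA.
Qed.

Lemma legal_from_mem (A : {set T}) (s : seq T) (x : T) :
  legal_from A s -> x \in s -> ~~ (N x \subset A).
Proof.
elim: s A => //= z s IHs A /andP[zA ls]; rewrite inE => /orP[/eqP->//|xs].
by apply: contra (IHs _ ls xs) => /subset_trans; apply; exact: subsetUl.
Qed.

Lemma legal_from_uniq (A : {set T}) (s : seq T) : legal_from A s -> uniq s.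
Proof.
elim: s A => //= x s IHs A /andP[_ ls]; rewrite (IHs _ ls) andbT.
by apply/negP => /(legal_from_mem ls); rewrite subsetUr.
Qed.

Lemma legal_from_forall (A : {set T}) (s : seq T) :
  legal_from A s =
  [forall i : 'I_(size s),
     ~~ (N (term i) \subset A :|: \bigcup_(j < size s | j < i) N (term j))].
Proof.
elim: s A => [|x s IHs] A /=; first by symmetry; apply/forallP => -[].
have termS (i : 'I_(size s)) :
    @term T (x :: s) (lift ord0 i) = term i.
  by rewrite /term !(tnth_nth x).
have cupS (i : 'I_(size s)) :
    \bigcup_(j < (size s).+1 | j < lift ord0 i) N (@term T (x :: s) j) =
    N x :|: \bigcup_(j < size s | j < i) N (term j).
  rewrite big_mkcond big_ord_recl /= [in RHS]big_mkcond; congr (_ :|: _).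
  by apply: eq_bigr => j _; rewrite termS.
rewrite IHs; apply/andP/forallP => [[xA /forallP ls] i|ls].
  case: (unliftP ord0 i) => [j|] ->; first by rewrite termS cupS setUA.
  by rewrite big_pred0 ?setU0.
split; first by have := ls ord0; rewrite big_pred0 ?setU0.
by apply/forallP => i; have := ls (lift ord0 i); rewrite termS cupS setUA.
Qed.

Lemma legalE (s : seq T) : legal N s = legal_from set0 s.
Proof.
have -> : legal N s = uniq s && legal_from set0 s.
  rewrite legal_from_forall /legal; congr (_ && _).
  by apply: eq_forallb => i; rewrite /footprint setD_eq0 set0U.
by case ls: legal_from; rewrite ?andbF // (legal_from_uniq ls).
Qed.

Lemma legal_size_max (s : seq T) : legal N s -> size s <= max_legal N.
Proof.
move=> ls; rewrite /max_legal.
exact: (@leq_bigmax_cond _ _ (fun s : {bseq #|T| of T} => size s)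
          (Bseq (legal_size ls))).
Qed.

Lemma max_legal_witness : exists2 s, legal N s & size s = max_legal N.
Proof.
have /(eq_bigmax_cond (fun s : {bseq #|T| of T} => size s)) :
    0 < #|[pred s : {bseq #|T| of T} | legal N s]|.
  (* The empty sequence is legal, so the maximum ranges over a nonempty family and is attained. *)
  by apply/card_gt0P; exists [bseq]; rewrite inE legalE.
by case=> s; rewrite inE => ls e; exists s => //; rewrite -e.
Qed.

End LegalFrom.

(* [p] transports witnesses of legality; it may differ from [f]. *)
Lemma legal_from_map (T U : finType) (N : T -> {set T}) (M : U -> {set U})
    (f p : T -> U) (A : {set T}) (B : {set U}) (s : seq T) :
  (forall x y, (p y \in M (f x)) = (y \in N x)) ->
  (forall y, p y \in B -> y \in A) ->
  legal_from N A s -> legal_from M B (map f s).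
Proof.
move=> pM; elim: s A B => //= x s IHs A B pB /andP[/subsetPn[y yx yA] ls].
apply/andP; split; first by apply/subsetPn; exists (p y); rewrite ?pM //;
  apply: contra yA; apply: pB.
apply: IHs ls => z; rewrite !inE pM => /orP[/pB->//|->].
by rewrite orbT.
Qed.

(** * Neighborhoods in the strong product *)

Lemma in_open_strong (G H : sgraph) (x y : G) (h w : H) :
  ((y, w) \in @open_nbhd (strong_prod G H) (x, h)) =
  [|| edge x y && (h == w), (x == y) && edge h w | edge x y && edge h w].
Proof. by rewrite inE. Qed.

Lemma in_open_strong_layer (G H : sgraph) (x y : G) (h : H) :
  ((y, h) \in @open_nbhd (strong_prod G H) (x, h)) = (y \in open_nbhd x).
Proof. by rewrite in_open_strong edge_irr eqxx !andbF !orbF andbT inE. Qed.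

Lemma in_open_strong_edge (G H : sgraph) (x y : G) (h w : H) : edge h w ->
  ((y, w) \in @open_nbhd (strong_prod G H) (x, h)) = (y \in closed_nbhd x).
Proof.
move=> hw; rewrite in_open_strong hw !andbT !inE eq_sym.
by case: edge; rewrite ?orbT ?orbF.
Qed.

Lemma in_open_strong_snd (G H : sgraph) (x y : strong_prod G H) :
  y \in open_nbhd x -> y.2 \in closed_nbhd x.2.
Proof.
case: x y => [x h] [y w]; rewrite in_open_strong !inE eq_sym /=.
by case/or3P=> /andP[_ ->]; rewrite ?orbT.
Qed.

Lemma grundy_dom_gt0 (G : sgraph) : 0 < grundy_dom G.
Proof.
have /card_gt0P[x _] := vertex_card_gt0 G.
apply: (@legal_size_max _ _ [:: x]); rewrite legalE /= andbT.
by apply/subsetPn; exists x; rewrite !inE ?eqxx.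
Qed.

(** In a longest sequence ending in [z], some [x] in N[z] is not covered before [z]. Since [x] lies
    in N[x], putting [x] in place of [z] keeps the sequence legal and of the same length. *)
Lemma grundy_dom_self_footprinting_last (G : sgraph) :
  exists (s : seq G) (x : G),
    [/\ legal_from (@closed_nbhd G) set0 (rcons s x),
        (size s).+1 = grundy_dom G & x \notin covered (@closed_nbhd G) s].
Proof.
have [s ls szs] := max_legal_witness (@closed_nbhd G).
have := grundy_dom_gt0 G; rewrite /grundy_dom -szs legalE in ls *.
case/lastP: s ls {szs} => // s z; rewrite size_rcons -cats1 legal_from_cat set0U.
rewrite /= andbT => /andP[ls /subsetPn[x _ xs]] _.
exists s, x; split=> //; rewrite -cats1 legal_from_cat ls set0U /= andbT.
by apply/subsetPn; exists x; rewrite // !inE eqxx.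
Qed.

(** * Blocks inside one layer *)

Section Blocks.

Variables (G H : sgraph) (X : {set H}) (A : {set strong_prod G H}).
(** In the application, [A] is what the earlier layers cover and [X] is the footprint of [h]. *)
Hypothesis disjAX : forall y : strong_prod G H, y \in A -> y.2 \notin X.
Variable h : H.

Let layer (x : G) : strong_prod G H := (x, h).

Lemma open_block : h \in X ->
  exists2 s : seq G, size s = grundy_total_dom G
    & legal_from (@open_nbhd (strong_prod G H)) A (map layer s).
Proof.
move=> hX; have [s] := max_legal_witness (@open_nbhd G).
rewrite legalE => ls szs; exists s => //.
apply: (legal_from_map (p := layer) _ _ ls) => [x y|y /disjAX].
  exact: in_open_strong_layer.
by rewrite hX.
Qed.

(** As [h] and [w] are adjacent, [(y, w)] is a neighbor of [(x, h)] exactly when [y] is in N[x]. So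
    a witness [y] moves to [(y, w)], which is outside [A] because [w] is in [X]. *)
Lemma closed_legal_layer (w : H) (s : seq G) : w \in X -> edge h w ->
  legal_from (@closed_nbhd G) set0 s ->
  legal_from (@open_nbhd (strong_prod G H)) A (map layer s).
Proof.
move=> wX hw.
apply: (legal_from_map (p := fun y => (y, w) : strong_prod G H)).
  by move=> x y; exact: in_open_strong_edge.
by move=> y /disjAX; rewrite wX.
Qed.

Lemma closed_block (w : H) : w \in X -> edge h w ->
  exists2 s : seq G, size s = grundy_dom G
    & legal_from (@open_nbhd (strong_prod G H)) A (map layer s).
Proof.
move=> wX hw; have [s] := max_legal_witness (@closed_nbhd G).
by rewrite legalE => ls szs; exists s => //; exact: (closed_legal_layer wX hw).
Qed.

Lemma closed_block_extra (w : H) : no_isolated G ->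
  h \in X -> w \in X -> edge h w ->
  exists2 s : seq G, size s = grundy_dom G + 1
    & legal_from (@open_nbhd (strong_prod G H)) A (map layer s).
Proof.
move=> hG hX wX hw.
have [s [x [ls szs xs]]] := grundy_dom_self_footprinting_last G.
have [y xy] := hG x.
exists (rcons s x ++ [:: y]); first by rewrite size_cat size_rcons szs.
rewrite map_cat legal_from_cat (closed_legal_layer wX hw ls) /= andbT.
apply/subsetPn; exists (layer x).
  by rewrite in_open_strong_layer inE edge_sym.
rewrite inE negb_or; apply/andP; split.
  by apply/negP => /disjAX; rewrite hX.
(* Within the layer adjacency is that of [G]: [x] is not adjacent to itself, and an edge from some
   [z] in [s] to [x] would make [x] covered by [s]. *)
apply/coveredP => -[_ /mapP[z zs ->]]; rewrite in_open_strong_layer.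
move: zs; rewrite mem_rcons inE => /orP[/eqP->|zs]; first by rewrite inE edge_irr.
move=> xz; case/coveredP: xs; exists z => //.
by rewrite in_setU xz orbT.
Qed.

End Blocks.

(** * Concatenating the blocks along [D] *)

Section Concatenation.

Variables (G H : sgraph) (D : seq H).

Definition block_size (i : 'I_(size D)) : nat :=
  if footprints_neighbor i then
    if footprints_self i then grundy_dom G + 1 else grundy_dom G
  else grundy_total_dom G.

Lemma block_exists (i : 'I_(size D)) (A : {set strong_prod G H}) :
  no_isolated G -> dominating_seq D ->
  (forall y, y \in A -> y.2 \notin footprint (@closed_nbhd H) i) ->
  exists2 s : seq G, size s = block_size i
    & legal_from (@open_nbhd (strong_prod G H)) A
        [seq ((x, term i) : strong_prod G H) | x <- s].
Proof.
move=> hG /andP[_ /forallP/(_ i)/set0Pn[v vi]] disj; rewrite /block_size.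
case: ifPn => [/existsP[w /andP[]]|nfn].
  rewrite inE => hw wi; case: ifPn => [hi|_].
    exact: closed_block_extra hG hi wi hw.
  exact: closed_block wi hw.
apply: open_block disj _ _.
(* The footprint contains some [v]; as no neighbor is footprinted, [v] is [term i] itself. *)
have := vi; rewrite {1}/footprint in_setD => /andP[_ /setU1P[<-//|vN]].
by case/existsP: nfn; exists v; rewrite vN.
Qed.

(** The last clause confines the sequence to the layers of the first [n] terms; the induction needs
    it to keep the next footprint free. *)
Lemma prefix_sequence (n : nat) : no_isolated G -> dominating_seq D ->
  n <= size D ->
  exists s : seq (strong_prod G H),
    [/\ legal (@open_nbhd (strong_prod G H)) s,
        size s = \sum_(i < size D | i < n) block_size i
      & forall z, z \in s -> exists2 j : 'I_(size D), j < n & z.2 = term j].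
Proof.
move=> hG domD; elim: n => [_|n IHn ltn].
  by exists [::]; rewrite legalE big_pred0.
have [s [ls szs sD]] := IHn (ltnW ltn).
pose i := Ordinal ltn.
(* Adjacency in the product projects into closed neighborhoods of [H], so whatever an earlier layer
   covers has its second coordinate in the closed neighborhood of an earlier term. *)
have disj y : y \in covered (@open_nbhd (strong_prod G H)) s ->
    y.2 \notin footprint (@closed_nbhd H) i.
  case/coveredP => z /sD[j jn ezj] /in_open_strong_snd yz.
  by rewrite in_setD negb_and negbK; apply/orP; left; apply/bigcupP; exists j;
    rewrite -?ezj.
have [t szt lt] := block_exists hG domD disj.
exists (s ++ [seq ((x, term i) : strong_prod G H) | x <- t]); split.
- by rewrite legalE legal_from_cat -legalE ls set0U.
- rewrite size_cat size_map szs szt [RHS](bigD1 i) //= addnC; congr (_ + _).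
  apply: eq_bigl => j; rewrite -(inj_eq val_inj) /= ltnS.
  by rewrite andbC -ltn_neqAle.
- move=> z; rewrite mem_cat => /orP[/sD[j jn ->]|/mapP[x _ ->]].
    by exists j => //; exact: ltnW.
  by exists i.
Qed.

Lemma sum_block_size : uniq D ->
  \sum_i block_size i =
  (grundy_dom G + 1) * c_count D + grundy_dom G * b_count D
  + (#|[set x in D]| - b_count D - c_count D) * grundy_total_dom G.
Proof.
move=> uD.
pose P := @footprints_neighbor H D; pose Q := @footprints_self H D.
have split_sum (F : 'I_(size D) -> nat) : \sum_i F i =
    \sum_(i in [set i | Q i && P i]) F i
    + \sum_(i in [set i | ~~ Q i && P i]) F i
    + \sum_(i in [set i | ~~ P i]) F i.
  rewrite (bigID P) /= (bigID Q) /=; congr (_ + _ + _);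
    by apply: eq_bigl => i; rewrite inE // andbC.
(* The summands are ordered so that both truncated subtractions cancel in turn, leaving the number
   of terms that footprint no neighbor. *)
have cardD : #|[set x in D]| = b_count D + (c_count D + #|[set i | ~~ P i]|).
  have -> : #|[set x in D]| = \sum_(i < size D) 1.
    by rewrite cardsE (card_uniqP uD) sum1_card card_ord.
  by rewrite split_sum !sum1_card addnA [b_count D + _]addnC.
rewrite cardD !addKn split_sum.
congr (_ + _ + _).
- rewrite mulnC -sum_nat_const; apply: eq_bigr => i.
  by rewrite inE /block_size -/(P i) -/(Q i) => /andP[-> ->].
- rewrite mulnC -sum_nat_const; apply: eq_bigr => i.
  by rewrite inE /block_size -/(P i) -/(Q i) => /andP[/negPf-> ->].
- rewrite -sum_nat_const; apply: eq_bigr => i.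
  by rewrite inE /block_size -/(P i) -/(Q i) => /negPf->.
Qed.

End Concatenation.

Unset Implicit Arguments.

(* The two truncated subtractions are exact: see [b_add_c_le]. *)
Theorem theorem4p1 (G H : sgraph) (hG : no_isolated G) :
  \max_(D : {bseq #|H| of H} | dominating_seq D)
      ((grundy_dom G + 1) * c_count D + grundy_dom G * b_count D
       + (#|[set x in (D : seq H)]| - b_count D - c_count D) * grundy_total_dom G)
  <= grundy_total_dom (strong_prod G H).
Proof.
apply/bigmax_leqP => D domD; have /andP[uD _] := domD.
have [s [ls szs _]] := prefix_sequence hG domD (leqnn _).
rewrite -(sum_block_size G uD).
have -> : \sum_(i < size D) block_size G i = size s.
  by rewrite szs; apply: eq_bigl => i; rewrite ltn_ord.
exact: legal_size_max.
Qed.
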